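(* Let $A \in M_n(\mathbb{H})$ be a diagonalizable matrix and let $B\in M_n(\mathbb{H})$ be a normal matrix. Let $\mu_1,\mu_2,\dots,\mu_n$ and $\delta_1, \delta_2, \ldots, \delta_n$ be the standard eigenvalues of $A$ and $B$ respectively. Let $X\in M_n(\mathbb{H})$ be a nonsingular matrix such that $X^{-1}AX=\operatorname{diag}(\mu_1,\mu_2,\dots,\mu_n)$. Then there exists a permutation $\pi$ of $\{1,2,\dots,n\}$ such that $$\sum_{i=1}^{n}|\mu_i-\delta_{\pi(i)}|^2\leq \|X\|_2^2\,\|X^{-1}\|_2^2\,\|A-B\|_F^2 .$$
   Context: $\mathbb{H}$ is the set of real quaternions and $M_n(\mathbb{H})$ is the set of $n\times n$ matrices over $\mathbb{H}$. For $A=(a_{ij})\in M_n(\mathbb{H})$, $A^*=(\bar a_{ji})$ is the conjugate transpose, and $A$ is normal if $AA^*=A^*A$. The Frobenius norm is $\|A\|_F=(\operatorname{trace} A^*A)^{1/2}$, i.e. $\|A\|_F^2=\sum_{i,j}|a_{ij}|^2$; the spectral norm is $\|A\|_2=\sup\{\|Ax\|_2/\|x\|_2 : x\in\mathbb{H}^n,\ x\neq 0\}$, where $\|x\|_2$ is the Euclidean norm on $\mathbb{H}^n$. A quaternion $\lambda_0$ is a right eigenvalue of $A$ if $Ax=x\lambda_0$ for some nonzero $x\in\mathbb{H}^n$. Every $A\in M_n(\mathbb{H})$ has exactly $n$ (counted with multiplicity) right eigenvalues that are complex numbers with nonnegative imaginary part; these are called the standard eigenvalues of $A$. Multiplicities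 are as follows: write $A=A_1+A_2 j$ with $A_1,A_2\in M_n(\mathbb{C})$ and let $\chi_A=\begin{bmatrix}A_1&A_2\\-\overline{A_2}&\overline{A_1}\end{bmatrix}\in M_{2n}(\mathbb{C})$; then $\lambda_1,\dots,\lambda_n$ (with nonnegative imaginary parts) are the standard eigenvalues of $A$ exactly when the eigenvalues of $\chi_A$, counted with algebraic multiplicity, are $\lambda_1,\dots,\lambda_n,\bar\lambda_1,\dots,\bar\lambda_n$. $A$ is diagonalizable if there is an invertible $S\in M_n(\mathbb{H})$ with $S^{-1}AS=\operatorname{diag}(\lambda_1,\dots,\lambda_n)$, where the $\lambda_i$ are the standard eigenvalues of $A$. *)

(* Defs.v *)
From HB Require Import structures.
From mathcomp Require Import all_boot all_order all_fingroup all_algebra.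
From mathcomp Require Import complex ring lra.
From mathcomp Require Import mathcomp_extra boolp classical_sets reals.

Set Implicit Arguments.
Unset Strict Implicit.
Unset Printing Implicit Defensive.

Import Order.TTheory GRing.Theory Num.Theory.
Import Normc.

Local Open Scope ring_scope.
Local Open Scope complex_scope.
Local Open Scope classical_set_scope.

(* Quat a b stands for a + b j with a, b complex; every quaternion
   w + x i + y j + z k has this form, with a = w + x i and b = y + z i. *)
Record quaternion (R : Type) := Quat { qfst : R[i]; qsnd : R[i] }.

Definition pair_of_quat (R : Type) (q : quaternion R) := (qfst q, qsnd q).
Definition quat_of_pair (R : Type) (p : R[i] * R[i]) := Quat p.1 p.2.
Lemma pair_of_quatK (R : Type) :
  cancel (@pair_of_quat R) (@quat_of_pair R).
Proof. by case. Qed.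

HB.instance Definition _ (R : eqType) := Equality.copy (quaternion R)
  (can_type (@pair_of_quatK R)).
HB.instance Definition _ (R : choiceType) := Choice.copy (quaternion R)
  (can_type (@pair_of_quatK R)).

Section QuaternionRing.
Variable R : rcfType.
Implicit Types p q r : quaternion R.

Definition qzero : quaternion R := Quat 0 0.
Definition qone : quaternion R := Quat 1 0.
Definition qopp q : quaternion R := Quat (- qfst q) (- qsnd q).
Definition qadd p q : quaternion R := Quat (qfst p + qfst q) (qsnd p + qsnd q).
(* Determined by j^2 = -1 and j z = z^* j for z complex. *)
Definition qmul p q : quaternion R :=
  Quat (qfst p * qfst q - qsnd p * (qsnd q)^*)
       (qfst p * qsnd q + qsnd p * (qfst q)^*).

Lemma qaddA : associative qadd.
Proof. by move=> p q r; rewrite /qadd /= !addrA. Qed.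
Lemma qaddC : commutative qadd.
Proof. by move=> p q; rewrite /qadd addrC [X in Quat _ X]addrC. Qed.
Lemma qadd0 : left_id qzero qadd.
Proof. by case=> a b; rewrite /qadd /= !add0r. Qed.
Lemma qaddN : left_inverse qzero qopp qadd.
Proof. by case=> a b; rewrite /qadd /= !addNr. Qed.

HB.instance Definition _ :=
  GRing.isZmodule.Build (quaternion R) qaddA qaddC qadd0 qaddN.

Lemma qmulA : associative qmul.
Proof.
move=> [[a b] [c d]] [[e f] [g h]] [[k l] [m n]].
by congr Quat; congr Complex => /=; ring.
Qed.
Lemma qmul1 : left_id qone qmul.
Proof. by move=> [[a b] [c d]]; congr Quat; congr Complex => /=; ring. Qed.
Lemma qmulr1 : right_id qone qmul.
Proof. by move=> [[a b] [c d]]; congr Quat; congr Complex => /=; ring. Qed.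
Lemma qmulDl : left_distributive qmul +%R.
Proof.
move=> [[a b] [c d]] [[e f] [g h]] [[k l] [m n]].
by congr Quat; congr Complex => /=; ring.
Qed.
Lemma qmulDr : right_distributive qmul +%R.
Proof.
move=> [[a b] [c d]] [[e f] [g h]] [[k l] [m n]].
by congr Quat; congr Complex => /=; ring.
Qed.
Lemma qone_neq0 : qone != 0.
Proof. by apply/eqP => -[] /eqP; rewrite oner_eq0. Qed.

HB.instance Definition _ := GRing.Zmodule_isNzRing.Build (quaternion R)
  qmulA qmul1 qmulr1 qmulDl qmulDr qone_neq0.

Definition qcomplex (z : R[i]) : quaternion R := Quat z 0.

Definition qconj q : quaternion R := Quat (qfst q)^* (- qsnd q).

Definition qnorm q : R := Num.sqrt (normc (qfst q) ^+ 2 + normc (qsnd q) ^+ 2).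

Definition qi : quaternion R := qcomplex 'i.
Definition qj : quaternion R := Quat 0 1.

Lemma qiqi : qi * qi = -1.
Proof. by congr Quat; congr Complex => /=; ring. Qed.
Lemma qjqj : qj * qj = -1.
Proof. by congr Quat; congr Complex => /=; ring. Qed.
Lemma qjqi : qj * qi = - (qi * qj).
Proof. by congr Quat; congr Complex => /=; ring. Qed.
Lemma qmul_conj q : qconj q * q = qcomplex (qnorm q ^+ 2)%:C.
Proof.
case: q => -[a b] [c d]; congr Quat; congr Complex => /=; try ring.
rewrite sqr_sqrtr ?addr_ge0 ?sqr_ge0 // !sqr_sqrtr ?addr_ge0 ?sqr_ge0 //.
ring.
Qed.
End QuaternionRing.

Section QuaternionMatrix.
Variable R : realType.
Local Notation H := (quaternion R).

Definition qadjmx m n (A : 'M[H]_(m, n)) : 'M[H]_(n, m) :=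
  \matrix_(i, j) qconj (A j i).

Definition qnormalmx n (A : 'M[H]_n) : Prop :=
  A *m qadjmx A = qadjmx A *m A.

Definition frobenius_norm m n (A : 'M[H]_(m, n)) : R :=
  Num.sqrt (\sum_(i < m) \sum_(j < n) qnorm (A i j) ^+ 2).

Definition euclidean_norm n (x : 'cV[H]_n) : R :=
  Num.sqrt (\sum_(i < n) qnorm (x i 0) ^+ 2).

Definition spectral_norm n (A : 'M[H]_n) : R :=
  sup [set euclidean_norm (A *m x) / euclidean_norm x | x in [set x | x != 0]].

(* invmx requires a commutative ring, so inverses are given explicitly. *)
Definition inverse_mx n (X Y : 'M[H]_n) : Prop :=
  X *m Y = 1%:M /\ Y *m X = 1%:M.

Definition right_eigenvalue n (A : 'M[H]_n) (l : H) : Prop :=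
  exists2 x : 'cV[H]_n, x != 0 & A *m x = map_mx (fun q => q * l) x.

Definition chi_mx n (A : 'M[H]_n) : 'M[R[i]]_(n + n) :=
  block_mx (map_mx (@qfst R) A) (map_mx (@qsnd R) A)
           (- map_mx (fun q => (qsnd q)^*) A) (map_mx (fun q => (qfst q)^*) A).

Definition standard_eigenvalues n (A : 'M[H]_n) (l : 'I_n -> R[i]) : Prop :=
  (forall i, 0 <= complex.Im (l i)) /\
  char_poly (chi_mx A) =
    \prod_(i < n) ('X - (l i)%:P) * \prod_(i < n) ('X - ((l i)^*)%:P).

Definition qdiag n (l : 'I_n -> R[i]) : 'M[H]_n :=
  diag_mx (\row_i qcomplex (l i)).

Definition qdiagonalizable n (A : 'M[H]_n) : Prop :=
  exists S Sinv : 'M[H]_n, exists l : 'I_n -> R[i],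
    [/\ inverse_mx S Sinv, standard_eigenvalues A l
      & Sinv *m A *m S = qdiag l].

Lemma right_eigenvalue_chi n (A : 'M[H]_n) (z : R[i]) :
  right_eigenvalue A (qcomplex z) <-> root (char_poly (chi_mx A)) z.
Proof.
have key (x : 'cV[H]_n) (v : 'cV[R[i]]_(n + n)) :
    v = col_mx (map_mx (@qfst R) x) (- map_mx (fun q => (qsnd q)^*) x) ->
    A *m x = map_mx (fun q => q * qcomplex z) x <-> chi_mx A *m v = z *: v.
  have qsum1 (F : 'I_n -> H) : qfst (\sum_i F i) = \sum_i qfst (F i).
    by apply: (big_morph (@qfst R)).
  have qsum2 (F : 'I_n -> H) : qsnd (\sum_i F i) = \sum_i qsnd (F i).
    by apply: (big_morph (@qsnd R)).
  move=> ->; rewrite /chi_mx mul_block_col scale_col_mx.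
  have E1 i : (map_mx (@qfst R) A *m map_mx (@qfst R) x +
      map_mx (@qsnd R) A *m - map_mx (fun q => (qsnd q)^*) x) i 0 =
      qfst ((A *m x) i 0).
    rewrite !mxE qsum1 -big_split /=; apply: eq_bigr => k _.
    by rewrite !mxE mulrN.
  have E2 i : (- map_mx (fun q => (qsnd q)^*) A *m map_mx (@qfst R) x +
      map_mx (fun q => (qfst q)^*) A *m - map_mx (fun q => (qsnd q)^*) x) i 0 =
      - (qsnd ((A *m x) i 0))^*.
    rewrite !mxE qsum2 -big_split /= rmorph_sum -sumrN; apply: eq_bigr => k _.
    rewrite !mxE /=; case: (A i k) (x k 0) => [[? ?] [? ?]] [[? ?] [? ?]].
    by congr Complex => /=; ring.
  split=> [Ax|/eq_col_mx [e1 e2]].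
    congr col_mx; apply/matrixP => i j; rewrite ord1 ?E1 ?E2 Ax !mxE /=;
    case: (x i 0) (z) => [[? ?] [? ?]] [? ?];
    by congr Complex => /=; ring.
  apply/matrixP => i j; rewrite ord1 [RHS]mxE.
  move/matrixP/(_ i 0): e1; rewrite E1 !mxE.
  move/matrixP/(_ i 0): e2; rewrite E2 !mxE.
  case: (\sum_j _) (x i 0) (z) => [[a b] [c d]] [[e f] [g h]] [k m] /=.
  move=> [e3 e4] [e5 e6]; congr Quat; congr Complex => /=; lra.
have -> : char_poly (chi_mx A) = char_poly (chi_mx A)^T.
  rewrite /char_poly -det_tr; congr (\det _).
  by apply/matrixP => i j; rewrite !mxE eq_sym.
rewrite -eigenvalue_root_char; split.
  case=> x x0 Ax; apply/eigenvalueP.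
  exists (col_mx (map_mx (@qfst R) x) (- map_mx (fun q => (qsnd q)^*) x))^T.
    by rewrite -trmx_mul ((key x _ erefl).1 Ax) linearZ.
  apply: contra_neq x0 => /(congr1 trmx); rewrite trmxK trmx0 -col_mx0.
  case/eq_col_mx => /matrixP e1 /matrixP e2.
  apply/matrixP => i j; move: (e1 i j) (e2 i j); rewrite !mxE.
  case: (x i j) => [[a b] [c d]] /= [-> ->] [c0 d0].
  by congr Quat; congr Complex; lra.
case/eigenvalueP => v vE v0.
pose x : 'cV[H]_n := \col_i Quat (v 0 (lshift n i)) (- (v 0 (rshift n i))^*).
have vx : v^T = col_mx (map_mx (@qfst R) x) (- map_mx (fun q => (qsnd q)^*) x).
  apply/matrixP => i j; rewrite ord1 mxE; case: (split_ordP i) => k ->.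
    by rewrite col_mxEu !mxE.
  rewrite col_mxEd !mxE /=; case: (v 0 _) => a b.
  by congr Complex => /=; ring.
exists x; last first.
  by apply: (key x _ vx).2; rewrite -[chi_mx A]trmxK -trmx_mul vE linearZ.
apply: contra_neq v0 => x0; rewrite -[v]trmxK vx x0.
apply/matrixP => i j; rewrite ord1 !mxE; case: split => k; rewrite !mxE //=.
by rewrite /GRing.zero /=; congr Complex => /=; rewrite !oppr0.
Qed.

Lemma standard_eigenvalues_right n (A : 'M[H]_n) (l : 'I_n -> R[i])
    (z : R[i]) : standard_eigenvalues A l ->
  0 <= complex.Im z /\ right_eigenvalue A (qcomplex z) <-> exists i, l i = z.
Proof.
case=> l0 chiE; rewrite right_eigenvalue_chi chiE rootM /root !horner_prod.
split=> [[z0 /orP[]/prodf_eq0[i _]]|[i <-]]; rewrite ?hornerXsubC ?subr_eq0.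
- by move/eqP ->; exists i.
- move/eqP => zE; exists i; move: (l0 i) z0; rewrite zE.
  case: (l i) => a b /= b0; rewrite oppr_ge0 => b0'.
  have -> : b = 0 by apply/le_anti; rewrite b0 b0'.
  by congr Complex => /=; ring.
- split; first exact: l0.
  apply/orP; left; apply/prodf_eq0; exists i => //.
  by rewrite hornerXsubC subrr.
Qed.
End QuaternionMatrix.

(* Main.v *)
(* Through the complex representation chi, A becomes diagonalizable with spectrum
   mu, conj mu, and B becomes normal with spectrum delta, conj delta. With
   Z = chi(X^-1) and D = diag(mu, conj mu), D Z - Z chi(B) = Z chi(A - B). The
   singular value decomposition of Z and an inequality for normal matrices bound
   the Frobenius distance of two normal matrices with these spectra, and that
   distance is a sum of |D_i - d_j|^2 with the doubly stochastic weights of a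
   unitary matrix. Since |mu - delta| <= |mu - conj delta| when both imaginary
   parts are nonnegative, the four n x n blocks of weights may be added, giving a
   matrix with all row and column sums 2; Birkhoff's theorem yields the
   permutation. *)
Require Import Defs.
From mathcomp Require Import all_boot all_order all_fingroup all_algebra.
From mathcomp Require Import complex reals ring lra zify.

Set Implicit Arguments.
Unset Strict Implicit.
Unset Printing Implicit Defensive.

Import Order.TTheory GRing.Theory Num.Theory.
Import Normc.

Local Open Scope ring_scope.
Local Open Scope complex_scope.

(** * Hall's marriage theorem *)

Definition neighbours (T U : finType) (E : {set T * U}) (A : {set T}) : {set U} :=
  [set y | [exists x in A, (x, y) \in E]].

Lemma neighboursP (T U : finType) (E : {set T * U}) (A : {set T}) (y : U) :
  reflect (exists2 x, x \in A & (x, y) \in E) (y \in neighbours E A).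
Proof. by rewrite inE; apply: (iffP exists_inP). Qed.

(* Rado's proof: if [a] has two neighbours [y1], [y2] and neither edge can be
   deleted, two violating sets [A1], [A2] contain [a], and Hall's condition fails
   for [A1 :|: A2] or for [(A1 :&: A2) :\ a] by submodularity. *)
Lemma hall (T U : finType) (E : {set T * U}) :
  (forall A : {set T}, (#|A| <= #|neighbours E A|)%N) ->
  exists2 f : T -> U, injective f & forall x, (x, f x) \in E.
Proof.
have [m] := ubnP #|E|; elim: m E => // m IH E ltEm hallE.
have hall_del a y : (a, y) \in E ->
    (forall A : {set T}, (#|A| <= #|neighbours (E :\ (a, y)) A|)%N) ->
    exists2 f : T -> U, injective f & forall x, (x, f x) \in E.
  move=> ayE hallE'; case: (IH (E :\ (a, y))) => //.
    by move: ltEm; rewrite (cardsD1 (a, y)) ayE.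
  by move=> f finj fE; exists f => // x; have := fE x; rewrite !inE => /andP[].
have viol a y : (a, y) \in E ->
    (exists2 f : T -> U, injective f & forall x, (x, f x) \in E) \/
    exists2 A : {set T}, a \in A & (#|neighbours (E :\ (a, y)) A| < #|A|)%N.
  move=> ayE.
  case: (boolP [forall A : {set T}, (#|A| <= #|neighbours (E :\ (a, y)) A|)%N]).
    by move/forallP => H; left; apply: (hall_del a y).
  case/forallPn => A; rewrite -ltnNge => ltA; right; exists A => //.
  (* If [a] is not in [A], deleting an edge at [a] leaves the neighbours of [A] unchanged, so [A]
     cannot violate Hall's condition. *)
  apply: contraTT ltA => aA; rewrite -leqNgt.
  apply: leq_trans (hallE A) (subset_leq_card _).
  apply/subsetP => z /neighboursP[x xA xzE]; apply/neighboursP; exists x => //.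
  by rewrite !inE xzE andbT xpair_eqE; apply: contraNN aA => /andP[/eqP <-].
case: (boolP [exists a, exists y1, exists y2,
   [&& y1 != y2, (a, y1) \in E & (a, y2) \in E]]).
  case/existsP => a /existsP[y1 /existsP[y2 /and3P[y12 e1 e2]]].
  case: (viol a y1 e1) => // -[A1 aA1 lt1].
  case: (viol a y2 e2) => // -[A2 aA2 lt2].
  exfalso.
  set N1 := neighbours _ A1 in lt1; set N2 := neighbours _ A2 in lt2.
  (* Nothing is lost in the union: since [y1 != y2], the edge to [y1] survives the deletion of
     [(a, y2)], and every other edge survives the deletion of [(a, y1)]. *)
  have subU : neighbours E (A1 :|: A2) \subset N1 :|: N2.
    apply/subsetP => z /neighboursP[x xA xzE]; rewrite inE.
    case: (eqVneq x a) => [xa|xa].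
      subst x; case: (eqVneq z y1) => [zy1|zy1].
        apply/orP; right; apply/neighboursP; exists a => //.
        by rewrite !inE xzE andbT xpair_eqE eqxx /= zy1.
      apply/orP; left; apply/neighboursP; exists a => //.
      by rewrite !inE xzE andbT xpair_eqE eqxx.
    by case/setUP: xA => xA; apply/orP; [left|right]; apply/neighboursP; exists x;
      rewrite // !inE xzE andbT xpair_eqE negb_and xa.
  have subI : neighbours E ((A1 :&: A2) :\ a) \subset N1 :&: N2.
    apply/subsetP => z /neighboursP[x]; rewrite !inE => /and3P[xa x1 x2] xzE.
    by apply/andP; split; apply/exists_inP; exists x => //;
      rewrite !inE xzE andbT xpair_eqE negb_and xa.
  (* The violations give [|N1| + |N2| <= |A1| + |A2| - 2]. Hall's condition for the two combined
     sets gives at least [|A1| + |A2| - 1], where the 1 accounts for removing [a] from the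
     intersection. *)
  have := leq_trans (hallE _) (subset_leq_card subU).
  have := leq_trans (hallE _) (subset_leq_card subI).
  have := cardsUI A1 A2; have := cardsUI N1 N2.
  by have := cardsD1 a (A1 :&: A2); rewrite !inE aA1 aA2 /=; lia.
(* Now every vertex has at most one neighbour. Hall's condition on singletons provides one, and on
   pairs it makes the resulting map injective. *)
move/existsPn => uniqE.
have nbr1 x : exists y, (x, y) \in E.
  have := hallE [set x]; rewrite cards1 card_gt0.
  by case/set0Pn => y /neighboursP[_ /set1P -> xyE]; exists y.
have [f fE] := fin_all_exists nbr1.
exists f => // a b fab; apply/eqP; apply/negPn/negP => ab.
have := hallE [set a; b]; rewrite cards2 ab leqNgt => /negP; apply.
rewrite /= ltnS -(cards1 (f a)); apply/subset_leq_card/subsetP => z.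
case/neighboursP => x; rewrite !inE => xab xzE.
have fxa : f x = f a by case/orP: xab => /eqP ->.
rewrite -fxa eq_sym; apply: contraT => fxz.
have /negP := uniqE x; case.
by apply/existsP; exists (f x); apply/existsP; exists z; rewrite fxz fE xzE.
Qed.

(** * Birkhoff's theorem in the form of a minimum over permutations *)

Lemma balanced_support_perm (R : realFieldType) (n : nat) (t : R)
    (S : 'I_n -> 'I_n -> R) :
  0 < t -> (forall i j, 0 <= S i j) ->
  (forall i, \sum_j S i j = t) -> (forall j, \sum_i S i j = t) ->
  exists s : 'S_n, forall i, 0 < S i (s i).
Proof.
move=> t0 S0 rowS colS.
have [|f finj fE] := @hall _ _ [set p : 'I_n * 'I_n | 0 < S p.1 p.2].
  (* Hall's condition by counting mass: the rows in [A] carry total [t * |A|], all of it in the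
     columns of [N], which carry only [t * |N|]. *)
  move=> A; set N := neighbours _ A.
  have zeroS i j : i \in A -> j \notin N -> S i j = 0.
    move=> iA; apply: contraNeq => Sij; apply/neighboursP; exists i => //.
    by rewrite inE lt_def Sij S0.
  rewrite -(ler_nat R) -(ler_pM2r t0) !mulr_natl -!sumr_const.
  have -> : \sum_(i in A) t = \sum_(i in A) \sum_j S i j.
    by apply: eq_bigr => i _; rewrite rowS.
  have -> : \sum_(j in N) t = \sum_(j in N) \sum_i S i j.
    by apply: eq_bigr => j _; rewrite colS.
  rewrite [leRHS]exchange_big /=.
  rewrite [leRHS](bigID (mem A)) /= ler_wpDr ?sumr_ge0 // => [i _|].
    by rewrite sumr_ge0.
  apply: ler_sum => i iA; rewrite (bigID (mem N)) /= [X in _ + X]big1 ?addr0 //.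
  by move=> j; apply: zeroS.
by exists (perm finj) => i; rewrite permE; have := fE i; rewrite inE.
Qed.

(* Birkhoff's decomposition: peel off the largest multiple of a permutation matrix
   contained in [S] and induct on the support. *)
Lemma balanced_min_perm (R : realFieldType) (n : nat) (t : R)
    (c S : 'I_n -> 'I_n -> R) :
  0 <= t -> (forall i j, 0 <= S i j) ->
  (forall i, \sum_j S i j = t) -> (forall j, \sum_i S i j = t) ->
  exists s : 'S_n, t * (\sum_i c i (s i)) <= \sum_i \sum_j c i j * S i j.
Proof.
have [m] := ubnP #|[set p : 'I_n * 'I_n | S p.1 p.2 != 0]|.
elim: m t S => // m IH t S ltm; rewrite le0r => /orP[/eqP ->|t0] S0 rowS colS.
  exists 1%g; rewrite mul0r sumr_ge0 // => i _; rewrite sumr_ge0 // => j _.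
  move: (rowS i) => /eqP; rewrite psumr_eq0 // => /allP/(_ j).
  by rewrite mem_index_enum => /(_ isT)/= /eqP ->; rewrite mulr0.
have [s sS] := balanced_support_perm t0 S0 rowS colS.
case: (posnP n) => [n0|n_gt0].
  by subst n; exists 1%g; rewrite !big_ord0 mulr0.
case: (@arg_minP _ _ _ (Ordinal n_gt0) predT (fun i => S i (s i)) isT) => k _ kmin.
set e := S k (s k) in kmin; pose S' i j := S i j - e * (j == s i)%:R.
have E1 (i : 'I_n) : \sum_j e * (j == s i)%:R = e.
  rewrite (bigD1 (s i)) //= eqxx mulr1 big1 ?addr0 // => j /negPf ->.
  by rewrite mulr0.
have E2 (j : 'I_n) : \sum_i e * (j == s i)%:R = e.
  rewrite (bigD1 (s^-1 j)%g) //= permKV eqxx mulr1 big1 ?addr0 // => i.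
  by rewrite eq_sym -(inj_eq (@perm_inj _ s)) permKV => /negPf ->; rewrite mulr0.
have ek : e <= t.
  by rewrite -(rowS k) (bigD1 (s k)) //= ler_wpDr ?sumr_ge0.
have [| | | | |s' s'S] := IH (t - e) S'.
(* [S] is positive along [s], so subtracting there creates no new nonzero entry outside the old
   support, and the entry at [(k, s k)], where the minimum [e] is attained, drops to zero. *)
- apply: leq_trans (proper_card _) ltm; apply/properP; split.
    apply/subsetP => -[i j]; rewrite !inE /= /S'; apply: contraNneq => Sij.
    rewrite Sij; case: (j =P s i) => [js|_]; last by rewrite mulr0 subrr.
    by have := sS i; rewrite -js Sij ltxx.
  exists (k, s k); rewrite !inE /= /S' ?eqxx ?mulr1 ?subrr ?eqxx //.
  by have := sS k; rewrite lt_def => /andP[].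
- by rewrite subr_ge0.
- move=> i j; rewrite /S' subr_ge0; case: eqP => [->|]; rewrite ?mulr1 ?mulr0 //.
  exact: kmin.
- by move=> i; rewrite sumrB rowS E1.
- by move=> j; rewrite sumrB colS E2.
have costS : \sum_i \sum_j c i j * S i j =
    \sum_i \sum_j c i j * S' i j + e * \sum_i c i (s i).
  rewrite mulr_sumr -big_split; apply: eq_bigr => i _ /=.
  rewrite /S' [in RHS](eq_bigr (fun j => c i j * S i j - c i j * (e * (j == s i)%:R)));
    last by move=> j _; rewrite mulrBr.
  rewrite sumrB.
  have -> : \sum_j c i j * (e * (j == s i)%:R) = e * c i (s i).
    rewrite (bigD1 (s i)) //= eqxx mulr1 big1 ?addr0 1?mulrC //.
    by move=> j /negPf ->; rewrite !mulr0.
  by rewrite subrK.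
have e0 : 0 <= e by rewrite S0.
have te : t = t - e + e by rewrite subrK.
(* The cost of [S] is at least [t - e] times the cost of [s'] plus [e] times the cost of [s], so the
   cheaper of the two permutations works. *)
rewrite costS; case: (leP (\sum_i c i (s i)) (\sum_i c i (s' i))) => [le_s|/ltW le_s].
  exists s; rewrite {1}te mulrDl lerD2r; apply: le_trans s'S.
  by rewrite ler_wpM2l // subr_ge0.
exists s'; rewrite {1}te mulrDl lerD // ler_wpM2l //.
Qed.

(** * Frobenius norms and perturbation of normal complex matrices *)

Section ComplexMatrices.
Variable C : numClosedFieldType.
Local Open Scope sesquilinear_scope.

Lemma trmxC_mul m n p (A : 'M[C]_(m, n)) (B : 'M[C]_(n, p)) :
  (A *m B)^t* = B^t* *m A^t*.
Proof. by rewrite trmx_mul map_mxM. Qed.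

Lemma trmxCD m n (A B : 'M[C]_(m, n)) : (A + B)^t* = A^t* + B^t*.
Proof. by rewrite linearD /= map_mxD. Qed.

Lemma trmxCN m n (A : 'M[C]_(m, n)) : (- A)^t* = - A^t*.
Proof. by rewrite linearN /= map_mxN. Qed.

Lemma unitarymxPl n (U : 'M[C]_n) : U \is unitarymx -> U^t* *m U = 1%:M.
Proof. by move=> /unitarymxP UV; apply: mulmx1C. Qed.

(** The squared Frobenius norm, written as a trace so that unitary factors cancel. On column vectors
    it is the squared Euclidean norm. *)
Definition sqfrob m n (M : 'M[C]_(m, n)) : C := \tr (M^t* *m M).

Lemma sqfrobE m n (M : 'M[C]_(m, n)) :
  sqfrob M = \sum_i \sum_j `|M i j| ^+ 2.
Proof.
rewrite exchange_big; apply: eq_bigr => j _; rewrite mxE.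
by apply: eq_bigr => i _; rewrite !mxE normCK mulrC.
Qed.

Lemma sqfrob_ge0 m n (M : 'M[C]_(m, n)) : 0 <= sqfrob M.
Proof.
by rewrite sqfrobE; do 2![apply: sumr_ge0 => ? _]; rewrite exprn_ge0.
Qed.

Lemma sqfrob_col m n (M : 'M[C]_(m, n)) : sqfrob M = \sum_j sqfrob (col j M).
Proof.
rewrite sqfrobE exchange_big; apply: eq_bigr => j _.
by rewrite sqfrobE; apply: eq_bigr => i _; rewrite big_ord1 mxE.
Qed.

Lemma sqfrob_colE m n (M : 'M[C]_(m, n)) j :
  sqfrob (col j M) = (M^t* *m M) j j.
Proof.
rewrite sqfrobE mxE; apply: eq_bigr => i _.
by rewrite big_ord1 !mxE normCK mulrC.
Qed.

Lemma sqfrob_unitaryl m n (U : 'M[C]_m) (M : 'M[C]_(m, n)) :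
  U \is unitarymx -> sqfrob (U *m M) = sqfrob M.
Proof.
by move=> /unitarymxPl UU; rewrite /sqfrob trmxC_mul mulmxA -(mulmxA _ _ U) UU mulmx1.
Qed.

Lemma sqfrob_unitaryr m n (U : 'M[C]_n) (M : 'M[C]_(m, n)) :
  U \is unitarymx -> sqfrob (M *m U) = sqfrob M.
Proof.
move=> /unitarymxP UU; rewrite /sqfrob trmxC_mul -mulmxA mxtrace_mulC.
by rewrite -!mulmxA UU mulmx1.
Qed.

(** The squared Frobenius norm is the sum over the columns, and the operator bound applies to each
    column of [M]. *)
Lemma sqfrob_mul_le m n p (Z : 'M[C]_(m, n)) (M : 'M[C]_(n, p)) k :
  (forall v : 'cV[C]_n, sqfrob (Z *m v) <= k * sqfrob v) ->
  sqfrob (Z *m M) <= k * sqfrob M.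
Proof.
move=> Zk; rewrite !(sqfrob_col (_ *m _)) (sqfrob_col M) mulr_sumr.
by apply: ler_sum => j _; rewrite colE -mulmxA -colE.
Qed.

Lemma trmxC_diag_real n (k : 'rV[C]_n) : (forall i, 0 <= k 0 i) ->
  (diag_mx k)^t* = diag_mx k.
Proof.
move=> k0; rewrite tr_diag_mx map_diag_mx; congr diag_mx.
by apply/rowP => i; rewrite mxE; apply/CrealP/ger0_real.
Qed.

Lemma mxtrace_diag_psd_ge0 m n (k : 'rV[C]_n) (M : 'M[C]_(m, n)) :
  (forall i, 0 <= k 0 i) -> 0 <= \tr (diag_mx k *m (M^t* *m M)).
Proof.
move=> k0; apply: sumr_ge0 => i _; rewrite mul_diag_mx !mxE mulr_ge0 //.
by apply: sumr_ge0 => j _; rewrite !mxE mulrC -normCK exprn_ge0.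
Qed.

Lemma sqfrobDZ m n (G M : 'M[C]_(m, n)) c : 0 <= c ->
  sqfrob (G + c *: M) =
    sqfrob G + c * (\tr (G^t* *m M) + \tr (M^t* *m G)) + c ^+ 2 * sqfrob M.
Proof.
move=> c0; have cM : (c *: M)^t* = c *: M^t*.
  by rewrite linearZ /= map_mxZ; congr (_ *: _); apply/CrealP/ger0_real.
rewrite /sqfrob trmxCD cM !mulmxDl !mulmxDr -!scalemxAl -!scalemxAr.
by rewrite !mxtraceD !mxtraceZ; ring.
Qed.

(* With [K = diag h - c], expand [N1 (K + c) - (K + c) N2 = G + c M]; for normal
   [N1], [N2] the cross term of [G] and [M] is [\tr (K (M^* M + M M^* ))]. *)
Lemma normal_diag_intertwine_le n (N1 N2 : 'M[C]_n) (h : 'rV[C]_n) (c : C) :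
  N1 *m N1^t* = N1^t* *m N1 -> N2 *m N2^t* = N2^t* *m N2 ->
  0 <= c -> (forall i, c <= h 0 i) ->
  c ^+ 2 * sqfrob (N1 - N2) <= sqfrob (N1 *m diag_mx h - diag_mx h *m N2).
Proof.
move=> N1n N2n c0 ch.
set M := N1 - N2; pose k := \row_i (h 0 i - c); pose K := diag_mx k.
have k0 i : 0 <= k 0 i by rewrite mxE subr_ge0.
have KK : K^t* = K by apply: trmxC_diag_real.
pose G := N1 *m K - K *m N2.
have hE : diag_mx h = K + c%:M.
  rewrite /K -diag_const_mx -linearD /=; congr diag_mx.
  by apply/rowP => i; rewrite !mxE subrK.
have -> : N1 *m diag_mx h - diag_mx h *m N2 = G + c *: M.
  rewrite hE mulmxDr mulmxDl scalar_mxC mul_scalar_mx mul_scalar_mx /G /M scalerBr.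
  by rewrite opprD addrACA.
have trB (U V : 'M[C]_n) : \tr (U - V) = \tr U - \tr V by rewrite raddfB.
have cross : \tr (G^t* *m M) + \tr (M^t* *m G) =
    \tr (K *m (M^t* *m M)) + \tr (K *m (M^t* ^t* *m M^t*)).
  have -> : \tr (G^t* *m M) =
      \tr (K *m (N1^t* *m M)) - \tr (K *m (M *m N2^t*)).
    rewrite /G trmxCD trmxCN !trmxC_mul KK mulmxDl mulNmx raddfB /=.
    rewrite -mulmxA -[N2^t* *m K *m M]mulmxA [\tr (N2^t* *m _)]mxtrace_mulC.
    by rewrite -[K *m M *m _]mulmxA.
  have -> : \tr (M^t* *m G) =
      \tr (K *m (M^t* *m N1)) - \tr (K *m (N2 *m M^t*)).
    rewrite /G mulmxDr mulmxN raddfB /=.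
    rewrite mulmxA mxtrace_mulC [\tr (M^t* *m _)]mxtrace_mulC.
    by rewrite -mulmxA.
  rewrite -!trB -!mxtraceD -!mulmxBr -!mulmxDr; congr (\tr (K *m _)).
  rewrite trmxCK /M !trmxCD !trmxCN !mulmxDl !mulmxDr !mulNmx !mulmxN N1n N2n.
  (* The six products become variables, so that passing to entries does not expand them into sums
     and [ring] sees them as atoms. *)
  move: (N1^t* *m N1) (N2^t* *m N2) (N1^t* *m N2) (N2^t* *m N1) (N1 *m N2^t* )
    (N2 *m N1^t* ) => a b e f g i.
  by apply/matrixP => i' j; rewrite !mxE; ring.
rewrite sqfrobDZ // cross lerDr addr_ge0 ?sqfrob_ge0 // mulr_ge0 // addr_ge0 //.
  exact: mxtrace_diag_psd_ge0.
exact: mxtrace_diag_psd_ge0.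
Qed.

Lemma unitary_conj_normal n (U N : 'M[C]_n) : U \is unitarymx ->
  N *m N^t* = N^t* *m N ->
  let N' := U *m N *m U^t* in N' *m N'^t* = N'^t* *m N'.
Proof.
move=> /unitarymxPl UU NN N'; rewrite /N' !trmxC_mul trmxCK.
have E (P Q : 'M[C]_n) : U *m P *m U^t* *m (U *m Q *m U^t* ) = U *m (P *m Q) *m U^t*.
  by rewrite -!mulmxA [U^t* *m (U *m _)]mulmxA UU mul1mx.
by rewrite [U *m (N^t* *m _)]mulmxA !E NN.
Qed.

Lemma diag_normal n (d : 'rV[C]_n) :
  diag_mx d *m (diag_mx d)^t* = (diag_mx d)^t* *m diag_mx d.
Proof. by rewrite tr_diag_mx map_diag_mx; apply: diag_mxC. Qed.

(** The [(i, j)] entry of the difference is [(d_i - b_j) T_ij]. *)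
Lemma sqfrob_diag_intertwine n (d b : 'rV[C]_n) (T : 'M[C]_n) :
  sqfrob (diag_mx d *m T - T *m diag_mx b) =
    \sum_i \sum_j `|d 0 i - b 0 j| ^+ 2 * `|T i j| ^+ 2.
Proof.
rewrite sqfrobE; apply: eq_bigr => i _; apply: eq_bigr => j _.
rewrite mul_diag_mx mul_mx_diag !mxE -exprMn -normrM.
by rewrite mulrBl [T i j * _]mulrC.
Qed.

Lemma unitarymx_row_sum n (T : 'M[C]_n) i :
  T \is unitarymx -> \sum_j `|T i j| ^+ 2 = 1.
Proof.
move=> /unitarymxP /matrixP/(_ i i); rewrite !mxE eqxx mulr1n => <-.
by apply: eq_bigr => j _; rewrite !mxE normCK.
Qed.

Lemma unitarymx_col_sum n (T : 'M[C]_n) j :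
  T \is unitarymx -> \sum_i `|T i j| ^+ 2 = 1.
Proof.
move=> /unitarymxPl /matrixP/(_ j j); rewrite !mxE eqxx mulr1n => <-.
by apply: eq_bigr => i _; rewrite !mxE normCK mulrC.
Qed.

Lemma normal_spectral n (B : 'M[C]_n) : B *m B^t* = B^t* *m B ->
  B = (spectralmx B)^t* *m diag_mx (spectral_diag B) *m spectralmx B.
Proof.
move=> /eqP Bn; rewrite {1}(orthomx_spectralP Bn).
by rewrite invmx_unitary ?spectral_unitarymx.
Qed.

(* The singular value decomposition [Z = Q (diag h) U] gives
   [(diag d) Z - Z B = Q (N1 (diag h) - (diag h) N2) U] with the normal matrices
   [N1 = Q^* (diag d) Q] and [N2 = U B U^*]. *)
Lemma normal_perturbation n (d : 'rV[C]_n) (B Z X : 'M[C]_n) (k : C) :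
  0 < k -> X *m Z = 1%:M -> B *m B^t* = B^t* *m B ->
  (forall v : 'cV[C]_n, sqfrob (X *m v) <= k * sqfrob v) ->
  exists2 T : 'M[C]_n, T \is unitarymx &
    \sum_i \sum_j `|d 0 i - spectral_diag B 0 j| ^+ 2 * `|T i j| ^+ 2 <=
      k * sqfrob (diag_mx d *m Z - Z *m B).
Proof.
move=> k0 XZ Bn Xk.
(* The singular value decomposition of [Z] is built from the spectral decomposition of [P]: [s]
   holds the squared singular values and [h] their square roots. *)
pose P := Z^t* *m Z.
have Pn : P *m P^t* = P^t* *m P by rewrite /P trmxC_mul trmxCK.
pose U := spectralmx P; pose s := spectral_diag P.
have Uu : U \is unitarymx := spectral_unitarymx P.
have UU := unitarymxP Uu; have UU' := unitarymxPl Uu.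
have sE : diag_mx s = (Z *m U^t* )^t* *m (Z *m U^t* ).
  rewrite trmxC_mul trmxCK !mulmxA -[U *m _ *m Z]mulmxA -/P (normal_spectral Pn).
  by rewrite -/U -/s !mulmxA UU mul1mx -mulmxA UU mulmx1.
(* As [X Z = 1], [X] maps column [i] of [Z U^*] to a unit vector. That column has squared norm
   [s_i], so the bound on [X] keeps the singular values away from zero. *)
have ks i : 1 <= k * s 0 i.
  have := Xk (col i (Z *m U^t* )).
  rewrite {1}colE !mulmxA XZ mul1mx -colE !sqfrob_colE -sE.
  by rewrite trmxCK UU !mxE eqxx !mulr1n.
have s0 i : 0 < s 0 i.
  by have := lt_le_trans ltr01 (ks i); rewrite pmulr_rgt0.
pose h := \row_i sqrtC (s 0 i).
have h0 i : 0 < h 0 i by rewrite mxE sqrtC_gt0.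
pose hi := \row_i (h 0 i)^-1.
have hhi : diag_mx h *m diag_mx hi = 1%:M.
  rewrite mulmx_diag -diag_const_mx; congr diag_mx.
  by apply/rowP => i; rewrite !mxE divff // gt_eqF //; have := h0 i; rewrite mxE.
have hih : diag_mx hi *m diag_mx h = 1%:M by apply: mulmx1C.
have hh : diag_mx h *m diag_mx h = diag_mx s.
  rewrite mulmx_diag; congr diag_mx.
  by apply/rowP => i; rewrite !mxE -expr2 sqrtCK.
pose Q := Z *m U^t* *m diag_mx hi.
have Qu : Q \is unitarymx.
  rewrite -trmxC_unitary; apply/unitarymxP; rewrite trmxCK /Q trmxC_mul.
  rewrite trmxC_diag_real => [|i]; last by rewrite mxE invr_ge0 ltW.
  rewrite mulmxA -[_ *m _ *m (Z *m _)]mulmxA -sE -hh.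
  by rewrite mulmxA hih mul1mx hhi.
have ZE : Z = Q *m diag_mx h *m U.
  by rewrite /Q -[_ *m diag_mx hi *m _]mulmxA hih mulmx1 -mulmxA UU' mulmx1.
have QQ' := unitarymxP Qu.
pose V := spectralmx B.
have Vu : V \is unitarymx := spectral_unitarymx B.
pose N1 := Q^t* *m diag_mx d *m Q; pose N2 := U *m B *m U^t*.
(* With [V] diagonalising [B], this unitary matrix turns the weighted sum into the squared Frobenius
   norm of [Q (N1 - N2) U V^*], which is that of [N1 - N2]. *)
exists (Q *m U *m V^t* ).
  apply: mul_unitarymx; rewrite ?trmxC_unitary ?Vu //; by apply: mul_unitarymx.
rewrite -sqfrob_diag_intertwine.
have -> : diag_mx d *m (Q *m U *m V^t* ) - Q *m U *m V^t* *m diag_mx (spectral_diag B)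
   = Q *m (N1 - N2) *m U *m V^t*.
  rewrite mulmxBr !mulmxBl /N1 /N2 {2}(normal_spectral Bn) -/V; congr (_ - _).
    by rewrite !mulmxA QQ' mul1mx.
  by rewrite -!mulmxA (mulmxA (U^t* ) U) UU' mul1mx (unitarymxP Vu) mulmx1.
rewrite 2?sqfrob_unitaryr ?trmxC_unitary // sqfrob_unitaryl //.
have -> : diag_mx d *m Z - Z *m B = Q *m (N1 *m diag_mx h - diag_mx h *m N2) *m U.
  rewrite mulmxBr !mulmxBl /N1 /N2 ZE; congr (_ - _).
    by rewrite !mulmxA QQ' mul1mx.
  by rewrite -!mulmxA UU' mulmx1.
rewrite sqfrob_unitaryr // sqfrob_unitaryl //.
rewrite -ler_pdivrMl // .
(* Since [s_i >= 1 / k], the constant [sqrtC k^-1] bounds every singular value [h_i] from below, as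
   the inequality for normal matrices requires. *)
have -> : k^-1 = (sqrtC k^-1) ^+ 2 by rewrite sqrtCK.
apply: normal_diag_intertwine_le.
- have := @unitary_conj_normal _ (Q^t* ) _ _ (diag_normal d).
  by rewrite trmxC_unitary trmxCK; apply.
- exact: unitary_conj_normal.
- by rewrite sqrtC_ge0 invr_ge0 ltW.
- move=> i; rewrite mxE ler_sqrtC ?nnegrE ?invr_ge0; try exact: ltW.
  by rewrite -[X in X <= _]mulr1 ler_pdivrMl.
Qed.
End ComplexMatrices.

Lemma char_poly_similar (F : comUnitRingType) n (P Q A : 'M[F]_n) :
  Q *m P = 1%:M -> char_poly (P *m A *m Q) = char_poly A.
Proof.
move=> QP; have PQ := mulmx1C QP.
have PQ1 : map_mx polyC P *m map_mx polyC Q = 1%:M.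
  by rewrite -map_mxM PQ map_mx1.
have -> : char_poly (P *m A *m Q) =
    \det (map_mx polyC P *m char_poly_mx A *m map_mx polyC Q).
  congr (\det _); rewrite /char_poly_mx mulmxBr mulmxBl !map_mxM scalar_mxC.
  by rewrite -[_%:M *m _ *m _]mulmxA PQ1 mulmx1.
by rewrite !det_mulmx mulrAC -det_mulmx PQ1 det1 mul1r.
Qed.

(** Each entry of [v] is at most the norm of [v] in modulus, so each entry of [A v] is at most an
    absolute row sum of [A] times that norm. This crude bound serves to show that the supremum in
    [spectral_norm] is finite. *)
Lemma sqfrob_bounded (C : numClosedFieldType) m n (A : 'M[C]_(m, n)) :
  exists2 k : C, 0 <= k & forall v : 'cV[C]_n, sqfrob (A *m v) <= k * sqfrob v.
Proof.
exists (\sum_i (\sum_j `|A i j|) ^+ 2) => [|v].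
  by apply: sumr_ge0 => i _; rewrite exprn_ge0 // sumr_ge0.
have v0 := sqfrob_ge0 v.
have vj j : `|v j 0| <= sqrtC (sqfrob v).
  rewrite -(ler_pXn2r (n := 2)) ?nnegrE ?sqrtC_ge0 // sqrtCK sqfrobE.
  rewrite (bigD1 j) //= big_ord1 lerDl sumr_ge0 // => i _.
  by rewrite big_ord1 exprn_ge0.
rewrite {1}sqfrobE mulr_suml; apply: ler_sum => i _.
rewrite big_ord1 -[X in _ * X]sqrtCK -exprMn ler_pXn2r ?nnegrE ?mulr_ge0 //;
  rewrite ?sumr_ge0 ?sqrtC_ge0 //.
rewrite mxE mulr_suml; apply: le_trans (ler_norm_sum _ _ _) _.
by apply: ler_sum => j _; rewrite normrM ler_wpM2l.
Qed.

(** * The complex representation of quaternion matrices and its norms *)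

Section ComplexMatrixRepresentation.
Variable R : realType.
Local Notation H := (quaternion R).
Local Open Scope sesquilinear_scope.

(** [B] is similar to the diagonal matrix of [spectral_diag B], so two products of monic linear
    factors agree, and such a product determines its roots up to order. *)
Lemma spectral_diag_perm n (B : 'M[R[i]]_n) (b : 'I_n -> R[i]) :
  B *m B^t* = B^t* *m B -> char_poly B = \prod_i ('X - (b i)%:P) ->
  exists s : 'S_n, forall i, spectral_diag B 0 i = b (s i).
Proof.
move=> Bn chB.
have e : \prod_(x <- [tuple spectral_diag B 0 i | i < n]) ('X - x%:P) =
         \prod_(x <- [tuple b i | i < n]) ('X - x%:P).
  rewrite !big_tuple; under [RHS]eq_bigr do rewrite tnth_mktuple.
  rewrite -chB {2}(normal_spectral Bn).
  rewrite char_poly_similar; last exact/unitarymxP/spectral_unitarymx.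
  rewrite char_poly_trig ?diag_mx_is_trig //.
  by apply: eq_bigr => i _; rewrite tnth_mktuple !mxE eqxx mulr1n.
have /tuple_permP[s sE] := prod_XsubC_eq e.
exists s => i; move/(congr1 (fun u => nth 0 u i)): sE.
by rewrite -!tnth_nth !tnth_mktuple.
Qed.

Lemma sqr_norm_normc (z : R[i]) : `|z| ^+ 2 = (normc z ^+ 2)%:C.
Proof. by rewrite rmorphXn. Qed.

Lemma qsqnormE (q : H) : (qnorm q ^+ 2)%:C = `|qfst q| ^+ 2 + `|qsnd q| ^+ 2.
Proof.
by rewrite /qnorm sqr_sqrtr ?addr_ge0 ?sqr_ge0 // rmorphD !sqr_norm_normc.
Qed.

Lemma map_qfstM m n p (A : 'M[H]_(m, n)) (B : 'M[H]_(n, p)) :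
  map_mx (@qfst R) (A *m B) = map_mx (@qfst R) A *m map_mx (@qfst R) B -
    map_mx (@qsnd R) A *m map_mx (fun q => (qsnd q)^*) B.
Proof.
apply/matrixP => i j; rewrite !mxE -sumrB.
rewrite (big_morph (@qfst R) (id1 := 0) (op1 := +%R)) //.
by apply: eq_bigr => k _; rewrite !mxE.
Qed.

Lemma map_qsndM m n p (A : 'M[H]_(m, n)) (B : 'M[H]_(n, p)) :
  map_mx (@qsnd R) (A *m B) = map_mx (@qfst R) A *m map_mx (@qsnd R) B +
    map_mx (@qsnd R) A *m map_mx (fun q => (qfst q)^*) B.
Proof.
apply/matrixP => i j; rewrite !mxE -big_split.
rewrite (big_morph (@qsnd R) (id1 := 0) (op1 := +%R)) //.
by apply: eq_bigr => k _; rewrite !mxE.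
Qed.

Lemma map_qfst_conj m n (A : 'M[H]_(m, n)) :
  map_mx (fun q => (qfst q)^*) A = map_mx (@conjc R) (map_mx (@qfst R) A).
Proof. by apply/matrixP => i j; rewrite !mxE. Qed.

Lemma map_qsnd_conj m n (A : 'M[H]_(m, n)) :
  map_mx (fun q => (qsnd q)^*) A = map_mx (@conjc R) (map_mx (@qsnd R) A).
Proof. by apply/matrixP => i j; rewrite !mxE. Qed.

Lemma map_conjcK m n (A : 'M[R[i]]_(m, n)) :
  map_mx (@conjc R) (map_mx (@conjc R) A) = A.
Proof. by apply/matrixP => i j; rewrite !mxE conjcK. Qed.

Lemma map_conjcM m n p (A : 'M[R[i]]_(m, n)) (B : 'M[R[i]]_(n, p)) :
  map_mx (@conjc R) (A *m B) = map_mx (@conjc R) A *m map_mx (@conjc R) B.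
Proof. exact: map_mxM. Qed.

(* The first block column of the complex representation of [x]. *)
Definition chi_cV n (x : 'cV[H]_n) : 'cV[R[i]]_(n + n) :=
  col_mx (map_mx (@qfst R) x) (- map_mx (fun q => (qsnd q)^*) x).

Lemma chi_mxM n (A B : 'M[H]_n) : chi_mx (A *m B) = chi_mx A *m chi_mx B.
Proof.
rewrite /chi_mx mulmx_block !map_qfst_conj !map_qsnd_conj map_qfstM map_qsndM.
rewrite !map_qfst_conj !map_qsnd_conj map_mxB map_mxD !map_conjcM !map_conjcK.
rewrite !mulmxN !mulNmx opprD.
set a1 := map_mx _ A; set a2 := map_mx _ A.
set b1 := map_mx _ B; set b2 := map_mx _ B.
set ca1 := map_mx _ a1; set cb1 := map_mx _ b1.
set ca2 := map_mx _ a2; set cb2 := map_mx _ b2.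
clearbody ca1 ca2 cb1 cb2 a1 a2 b1 b2.
by rewrite [- (ca1 *m cb2) - _]addrC [- (ca2 *m b2) + _]addrC.
Qed.

Lemma chi_mx_cV n (A : 'M[H]_n) (x : 'cV[H]_n) :
  chi_mx A *m chi_cV x = chi_cV (A *m x).
Proof.
rewrite /chi_mx /chi_cV mul_block_col !map_qfst_conj !map_qsnd_conj.
rewrite map_qfstM map_qsndM !map_qfst_conj !map_qsnd_conj map_mxD !map_conjcM !map_conjcK.
by rewrite !mulmxN !mulNmx opprD [- _ - _]addrC.
Qed.

Lemma chi_mxB n (A B : 'M[H]_n) : chi_mx (A - B) = chi_mx A - chi_mx B.
Proof.
rewrite /chi_mx opp_block_mx add_block_mx; congr block_mx;
  by apply/matrixP => i j; rewrite !mxE ?rmorphB ?opprB ?opprK //= addrC.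
Qed.

Lemma chi_mx1 n : chi_mx (1%:M : 'M[H]_n) = 1%:M.
Proof.
rewrite scalar_mx_block /chi_mx; congr block_mx; apply/matrixP => i j;
  by rewrite !mxE; case: (i == j); rewrite //= ?conjc0 ?conjc1 ?oppr0.
Qed.

Lemma chi_mx_adj n (A : 'M[H]_n) : chi_mx (qadjmx A) = (chi_mx A)^t*.
Proof.
have conjE (z : R[i]) : Num.conj z = conjc z by [].
rewrite /chi_mx tr_block_mx map_block_mx; congr block_mx;
  apply/matrixP => i j; rewrite !mxE //= conjE rmorphN /= ?conjcK //.
by rewrite opprK.
Qed.

Lemma chi_mx_qdiag n (l : 'I_n -> R[i]) :
  chi_mx (qdiag l) = diag_mx (row_mx (\row_i l i) (\row_i (l i)^*)).
Proof.
rewrite diag_mx_row /chi_mx; congr block_mx;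
  apply/matrixP => i j; rewrite !mxE; case: (i == j);
  by rewrite ?mulr1n ?mulr0n /= ?conjc0 ?oppr0.
Qed.

Lemma sqfrob_chi n (A : 'M[H]_n) :
  sqfrob (chi_mx A) = 2 * (frobenius_norm A ^+ 2)%:C.
Proof.
rewrite sqfrobE big_split_ord /= -!big_split mulr_natl mulr2n.
rewrite /frobenius_norm sqr_sqrtr; last first.
  by do 2![apply: sumr_ge0 => ? _]; rewrite sqr_ge0.
rewrite rmorph_sum -big_split; apply: eq_bigr => i _ /=.
rewrite !big_split_ord /= rmorph_sum -!big_split; apply: eq_bigr => j _ /=.
rewrite block_mxEul block_mxEur block_mxEdl block_mxEdr !mxE qsqnormE.
by rewrite normrN !normcJ; ring.
Qed.

Lemma sqfrob_chi_cV n (x : 'cV[H]_n) :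
  sqfrob (chi_cV x) = (euclidean_norm x ^+ 2)%:C.
Proof.
rewrite sqfrobE big_split_ord /= /euclidean_norm sqr_sqrtr; last first.
  by apply: sumr_ge0 => ? _; rewrite sqr_ge0.
rewrite rmorph_sum -big_split; apply: eq_bigr => i _ /=.
by rewrite !big_ord1 col_mxEu col_mxEd !mxE normrN normcJ qsqnormE.
Qed.

Lemma chi_cV_surj n (v : 'cV[R[i]]_(n + n)) : exists x, v = chi_cV x.
Proof.
exists (\col_i Quat (v (lshift n i) 0) (- (v (rshift n i) 0)^*)).
apply/matrixP => i j; rewrite ord1; case: (split_ordP i) => k ->.
  by rewrite col_mxEu !mxE.
by rewrite col_mxEd !mxE rmorphN /= conjcK opprK.
Qed.

Lemma euclidean_norm_ge0 n (x : 'cV[H]_n) : 0 <= euclidean_norm x.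
Proof. exact: sqrtr_ge0. Qed.

Lemma euclidean_norm_eq0 n (x : 'cV[H]_n) : euclidean_norm x = 0 -> x = 0.
Proof.
move=> x0; have : sqfrob (chi_cV x) = 0 by rewrite sqfrob_chi_cV x0 expr0n.
move/eqP; rewrite sqfrobE psumr_eq0 => [/allP xi0|i _]; last first.
  by rewrite sumr_ge0 // => j _; rewrite exprn_ge0.
have chi0 i : chi_cV x i 0 = 0.
  have := xi0 i; rewrite mem_index_enum big_ord1 => /(_ isT).
  by rewrite /= sqrf_eq0 normr_eq0 => /eqP.
apply/matrixP => i j; rewrite ord1 mxE.
have := chi0 (lshift n i); have := chi0 (rshift n i).
rewrite col_mxEu col_mxEd !mxE; case: (x i 0) => a b /= /eqP.
by rewrite oppr_eq0 conjc_eq0 => /eqP -> ->.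
Qed.

Lemma euclidean_norm0 n : euclidean_norm (0 : 'cV[H]_n) = 0.
Proof.
apply/eqP; rewrite sqrtr_eq0 big1 // => i _; rewrite mxE /qnorm.
by rewrite normc0 expr0n addr0 sqrtr0 expr0n.
Qed.

Lemma spectral_norm_bound n (A : 'M[H]_n) (x : 'cV[H]_n) :
  euclidean_norm (A *m x) <= spectral_norm A * euclidean_norm x.
Proof.
case: (eqVneq x 0) => [->|x0].
  by rewrite mulmx0 euclidean_norm0 mulr0.
have nx (y : 'cV[H]_n) : y != 0 -> 0 < euclidean_norm y.
  move=> y0; rewrite lt_def euclidean_norm_ge0 andbT; apply: contra_neq y0.
  exact: euclidean_norm_eq0.
rewrite -ler_pdivrMr ?nx //; apply: ub_le_sup; last by exists x.
(* The supremum dominates its members only once the set is known to be bounded above. The bound is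
   transferred from [chi_mx A]. *)
have [k k0 Ak] := sqfrob_bounded (chi_mx A).
exists (Num.sqrt (complex.Re k)) => _ [y /= y0 <-].
have kR : k = (complex.Re k)%:C by rewrite RRe_real // ger0_real.
rewrite ler_pdivrMr ?nx // -(ler_pXn2r (n := 2)) ?nnegrE ?mulr_ge0 //;
  try exact: sqrtr_ge0.
have Rk0 : 0 <= complex.Re k by rewrite -ler0c -kR.
rewrite exprMn (sqr_sqrtr Rk0) -lecR [leRHS]rmorphM /= -kR.
by rewrite -!sqfrob_chi_cV -chi_mx_cV.
Qed.

(** Every complex vector of length [n + n] is [chi_cV x] for a quaternionic [x] of the same norm, so
    the bound for [A] covers all vectors on which [chi_mx A] acts. *)
Lemma sqfrob_spectral_norm n (A : 'M[H]_n) (v : 'cV[R[i]]_(n + n)) :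
  sqfrob (chi_mx A *m v) <= (spectral_norm A ^+ 2)%:C * sqfrob v.
Proof.
have [x ->] := chi_cV_surj v.
rewrite chi_mx_cV !sqfrob_chi_cV -rmorphM lecR -exprMn lerXn2r ?nnegrE //.
- exact: euclidean_norm_ge0.
- exact: le_trans (euclidean_norm_ge0 _) (spectral_norm_bound A x).
- exact: spectral_norm_bound.
Qed.

(** [chi_mx X] sends column 0 of [chi_mx Xinv] to a unit vector, so a zero norm would give [1 <= 0].
    For [n = 0] the supremum would range over an empty set. *)
Lemma sqr_spectral_norm_gt0 n (X Xinv : 'M[H]_n) : (0 < n)%N ->
  X *m Xinv = 1%:M -> 0 < spectral_norm X ^+ 2.
Proof.
case: n X Xinv => // n X Xinv _ XX; rewrite lt_def sqr_ge0 andbT.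
apply/eqP => X0.
have := sqfrob_spectral_norm X (col 0 (chi_mx Xinv)).
rewrite colE mulmxA -chi_mxM XX chi_mx1 mul1mx X0 mul0r sqfrobE.
rewrite (bigD1 0) //= big_ord1 mxE eqxx normr1 expr1n => le0.
have : (1 : R[i]) <= 0.
  apply: le_trans le0; rewrite lerDl sumr_ge0 // => i _.
  by rewrite big_ord1 exprn_ge0.
by rewrite ler10.
Qed.

Lemma real_complex_double (x y z : R) :
  (2 * (x * y * z))%:C = x%:C * (y%:C * (2 * z%:C)).
Proof. by rewrite !rmorphM /= rmorph_nat; ring. Qed.

(** The two squares differ by four times the product of the imaginary parts. *)
Lemma normc_sub_conj_le (a b : R[i]) :
  0 <= complex.Im a -> 0 <= complex.Im b ->
  normc (a - b) ^+ 2 <= normc (a - b^*) ^+ 2.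
Proof.
case: a b => [a1 a2] [b1 b2] /= a0 b0.
rewrite !sqr_sqrtr ?addr_ge0 ?sqr_ge0 //; nra.
Qed.

Lemma normc_conj (a : R[i]) : normc a^* = normc a.
Proof. by case: a => a b /=; rewrite sqrrN. Qed.
End ComplexMatrixRepresentation.

(** * Folding the complex spectra back to standard eigenvalues *)

Theorem theorem3p2 (R : realType) (n : nat)
    (A B X Xinv : 'M[quaternion R]_n) (mu delta : 'I_n -> R[i])
    (hA : qdiagonalizable A) (hB : qnormalmx B)
    (hmu : standard_eigenvalues A mu)
    (hdelta : standard_eigenvalues B delta)
    (hX : inverse_mx X Xinv)
    (hdiag : Xinv *m A *m X = qdiag mu) :
  exists pi : 'S_n,
    \sum_(i < n) normc (mu i - delta (pi i)) ^+ 2 <=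
      spectral_norm X ^+ 2 * spectral_norm Xinv ^+ 2
        * frobenius_norm (A - B) ^+ 2.
Proof.
case: (posnP n) => [n0|n_gt0].
  subst n; exists 1%g; rewrite big_ord0.
  by apply: mulr_ge0; [apply: mulr_ge0|]; apply: sqr_ge0.
case: hX => XXinv XinvX; case: hmu => mu0 _; case: hdelta => delta0 chB.
pose d := row_mx (\row_i mu i) (\row_i (mu i)^* ).
pose b := row_mx (\row_i delta i) (\row_i (delta i)^* ).
set Z := chi_mx Xinv.
have Bn : chi_mx B *m (chi_mx B ^t Num.conj)%sesqui =
          (chi_mx B ^t Num.conj)%sesqui *m chi_mx B.
  by rewrite -!chi_mx_adj -!chi_mxM hB.
have [s sE] : exists s : 'S_(n + n),
    forall i, spectral_diag (chi_mx B) 0 i = b 0 (s i).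
  apply: spectral_diag_perm => //; rewrite chB big_split_ord /=.
  by congr (_ * _); apply: eq_bigr => i _; rewrite ?row_mxEl ?row_mxEr mxE.
have DZ : diag_mx d *m Z = Z *m chi_mx A.
  by rewrite -chi_mx_qdiag -hdiag -!chi_mxM -mulmxA XXinv mulmx1.
have k0 : 0 < (spectral_norm X ^+ 2)%:C.
  by rewrite ltcR (sqr_spectral_norm_gt0 n_gt0 XXinv).
have XZ : chi_mx X *m Z = 1%:M by rewrite -chi_mxM XXinv chi_mx1.
have [T Tu] := normal_perturbation d k0 XZ Bn (sqfrob_spectral_norm X).
(* The columns of [T] follow the order of [spectral_diag]. Reindexing by [s^-1] aligns them with
   [b], that is [delta] followed by its conjugates. *)
pose w i j : R := normc (T i ((s^-1)%g j)) ^+ 2.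
pose c i j : R := normc (d 0 i - b 0 j) ^+ 2.
have w0 i j : 0 <= w i j by rewrite sqr_ge0.
have roww i : \sum_j w i j = 1.
  apply: complexI; rewrite rmorph_sum rmorph1 -(unitarymx_row_sum i Tu).
  rewrite [RHS](reindex_perm s^-1).
  by apply: eq_bigr => j _; rewrite sqr_norm_normc.
have colw j : \sum_i w i j = 1.
  apply: complexI; rewrite rmorph_sum rmorph1 -(unitarymx_col_sum (s^-1 j)%g Tu).
  by apply: eq_bigr => i _; rewrite sqr_norm_normc.
set rhs := spectral_norm X ^+ 2 * _ * _ => Tle.
have {Tle} wle : \sum_i \sum_j c i j * w i j <= 2 * rhs.
  have LE : (\sum_i \sum_j c i j * w i j)%:C = \sum_i \sum_j
      `|d 0 i - spectral_diag (chi_mx B) 0 j| ^+ 2 * `|T i j| ^+ 2.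
    rewrite rmorph_sum; apply: eq_bigr => i _ /=.
    rewrite rmorph_sum [RHS](reindex_perm s^-1); apply: eq_bigr => j _.
    by rewrite sE permKV !sqr_norm_normc -rmorphM.
  rewrite -lecR LE; apply: le_trans Tle _.
  (* The factor 2 arises because [chi_mx] contains each complex component of a quaternionic entry
     twice up to sign and conjugation. It later cancels against the row sums 2 of [S]. *)
  have -> : (2 * rhs)%:C = (spectral_norm X ^+ 2)%:C *
      ((spectral_norm Xinv ^+ 2)%:C * sqfrob (chi_mx (A - B))).
    by rewrite sqfrob_chi; apply: real_complex_double.
  rewrite ler_wpM2l ?(ltW k0) // DZ -mulmxBr -chi_mxB.
  exact/sqfrob_mul_le/sqfrob_spectral_norm.
pose L (i : 'I_n) := lshift n i; pose Rt (i : 'I_n) := rshift n i.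
pose S i j := (w (L i) (L j) + w (L i) (Rt j)) + (w (Rt i) (L j) + w (Rt i) (Rt j)).
have S0 i j : 0 <= S i j by rewrite !addr_ge0.
have rowS i : \sum_j S i j = 2.
  rewrite big_split /= !big_split /=.
  by have := roww (L i); have := roww (Rt i); rewrite !big_split_ord /= => -> ->.
have colS j : \sum_i S i j = 2.
  rewrite /S; under eq_bigr do rewrite addrACA.
  rewrite big_split /= !big_split /=.
  by have := colw (L j); have := colw (Rt j); rewrite !big_split_ord /= => -> ->.
have [p pS] := balanced_min_perm (fun i j => normc (mu i - delta j) ^+ 2)
   (ler0n _ 2) S0 rowS colS.
exists p; rewrite -(ler_pM2l (ltr0n _ 2)); apply: le_trans wle.
apply: le_trans pS _.
rewrite [leRHS]big_split_ord /= -big_split /=; apply: ler_sum => i _ /=.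
rewrite !big_split_ord /= -!big_split /=; apply: ler_sum => j _.
have cLL : normc (mu i - delta j) ^+ 2 <= c (L i) (L j).
  by rewrite /c !row_mxEl !mxE.
have cRR : normc (mu i - delta j) ^+ 2 <= c (Rt i) (Rt j).
  by rewrite /c !row_mxEr !mxE -rmorphB normc_conj.
have cLR : normc (mu i - delta j) ^+ 2 <= c (L i) (Rt j).
  by rewrite /c row_mxEl row_mxEr !mxE normc_sub_conj_le.
(* Conjugating the whole difference moves the conjugate from [mu] to [delta], which reduces this
   block to the previous one. *)
have cRL : normc (mu i - delta j) ^+ 2 <= c (Rt i) (L j).
  rewrite /c row_mxEl row_mxEr !mxE -[X in _ <= X ^+ 2]normc_conj rmorphB /= conjcK.
  exact: normc_sub_conj_le.
by rewrite /S !mulrDr; apply: lerD; apply: lerD; apply: ler_wpM2r.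
Qed.
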